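(* Let $M$ be a generalized constant ratio (GCR) hypersurface in $\mathbb{E}^{n+1}$, let $e_1$ be the unit tangent vector field proportional to the tangential component $x^T$ of the position vector $x$ of $M$, and let $k_1$ be the principal curvature of $M$ corresponding to the principal direction $e_1$. Let $\alpha$ be an integral curve of $e_1$. Then $\alpha$ is a geodesic and a line of curvature of $M$. Furthermore, $\alpha$ is planar and its curvature in $\mathbb{E}^{n+1}$ is $k_1|_\alpha$.
   Context: $\mathbb{E}^{n+1}$ is Euclidean space with its canonical metric. Hypersurfaces are smooth, connected, immersed and oriented, with unit normal $N$ and shape operator $S(X)=-\widetilde\nabla_XN$; principal directions and principal curvatures are the eigenvectors and eigenvalues of $S$. The position vector $x$ (with respect to the origin) is decomposed along $M$ as $x=x^T+x^\perp$ into tangential and normal components. A hypersurface is called a generalized constant ratio (GCR) hypersurface if $x^T$ is one of its principal directions. The vector field $e_1$ is defined where $x^T\ne0$. *)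

(* Defs.v *)
From HB Require Import structures.
From mathcomp Require Import all_boot all_order all_algebra.
From mathcomp Require Import all_classical all_reals all_analysis.

Set Implicit Arguments.
Unset Strict Implicit.
Unset Printing Implicit Defensive.

Import Order.TTheory GRing.Theory Num.Theory.
Import numFieldNormedType.Exports.

Local Open Scope classical_set_scope.
Local Open Scope ring_scope.

(* The library's norm on 'rV[R]_m is the sup norm: it gives the right topology
   and differentials, but lengths and angles in E^m come from [dotr]. *)
Definition dotr (R : realType) (m : nat) (u v : 'rV[R]_m) : R :=
  \sum_(i < m) u 0 i * v 0 i.

Definition enorm (R : realType) (m : nat) (u : 'rV[R]_m) : R :=
  Num.sqrt (dotr u u).

(* C^oo on a set [U], meant to be open: all the iterated directional
   derivatives D_v1 (D_v2 ... f), including f itself, are Frechet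
   differentiable at the points of [U]. *)
Definition smooth_on (R : realType) (V W : normedModType R)
    (U : set V) (f : V -> W) : Prop :=
  forall (vs : seq V) (a : V), U a ->
    differentiable (foldr (fun v g => 'D_v g) f vs) a.

(** Manifolds *)

(* [chart_fun] and [chart_inv] are total; only their values on [chart_dom] and
   on its image are meaningful. *)
Record chart (R : realType) (n : nat) (M : topologicalType) := Chart {
  chart_dom : set M ;
  chart_fun :> M -> 'rV[R]_n ;
  chart_inv : 'rV[R]_n -> M ;
  open_chart_dom : open chart_dom ;
  open_chart_image : open (chart_fun @` chart_dom) ;
  chart_funK : {in chart_dom, cancel chart_fun chart_inv} ;
  chart_fun_continuous : forall p, chart_dom p -> {for p, continuous chart_fun} ;
  chart_inv_continuous : forall a, (chart_fun @` chart_dom) a ->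
    {for a, continuous chart_inv}
}.

(* Each point carries a preferred chart of the atlas, used to represent
   tangent vectors at that point as elements of 'rV[R]_n. *)
Record manifold (R : realType) (n : nat) := Manifold {
  carrier :> topologicalType ;
  carrier_hausdorff : hausdorff_space carrier ;
  carrier_second_countable : @second_countable carrier ;
  atlas : set (chart R n carrier) ;
  chart_at : carrier -> chart R n carrier ;
  chart_at_atlas : forall p, atlas (chart_at p) ;
  chart_at_dom : forall p, chart_dom (chart_at p) p ;
  atlas_compatible : forall c c', atlas c -> atlas c' ->
    smooth_on (c @` (chart_dom c `&` chart_dom c')) (c' \o chart_inv c)
}.

Definition smooth_map (R : realType) (n m : nat) (M : manifold R n)
    (f : M -> 'rV[R]_m) : Prop :=
  forall c, atlas c -> smooth_on (c @` chart_dom c) (f \o chart_inv c).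

Definition differential (R : realType) (n m : nat) (M : manifold R n)
    (f : M -> 'rV[R]_m) (p : M) (v : 'rV[R]_n) : 'rV[R]_m :=
  'd (f \o chart_inv (chart_at p)) (chart_at p p) v.

(* The velocity of a curve, as a tangent vector in the preferred chart. *)
Definition velocity (R : realType) (n : nat) (M : manifold R n)
    (alpha : R -> M) (t : R) : 'rV[R]_n :=
  derive1 (chart_at (alpha t) \o alpha) t.

Definition differentiable_curve (R : realType) (n : nat) (M : manifold R n)
    (J : set R) (alpha : R -> M) : Prop :=
  forall t, J t -> {for t, continuous alpha} /\
    derivable (chart_at (alpha t) \o alpha) t 1.

(** Hypersurfaces of Euclidean space *)

(* Connected, immersed (possibly with self-intersections) and oriented by a
   globally defined unit normal field. *)
Record hypersurface (R : realType) (n : nat) := Hypersurface {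
  domain :> manifold R n ;
  domain_connected : connected [set: domain] ;
  position : domain -> 'rV[R]_n.+1 ;
  position_smooth : smooth_map position ;
  position_immersion : forall p, injective (differential position p) ;
  normal : domain -> 'rV[R]_n.+1 ;
  normal_smooth : smooth_map normal ;
  normal_unit : forall p, dotr (normal p) (normal p) = 1 ;
  normal_orthogonal : forall p v,
    dotr (normal p) (differential position p v) = 0
}.

Section Hypersurface.
Variables (R : realType) (n : nat) (M : hypersurface R n).

Local Notation x := (@position R n M).
Local Notation N := (@normal R n M).

(* S(v) = - D_v N, seen in E^(n+1): the tangent space at [p] is identified with
   its image under the differential of the position vector. *)
Definition shape_operator (p : M) (v : 'rV[R]_n) : 'rV[R]_n.+1 :=
  - differential N p v.

(* [X], a vector of E^(n+1), is tangent at [p] and a nonzero eigenvector of the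
   shape operator, with eigenvalue [k]. *)
Definition principal (p : M) (X : 'rV[R]_n.+1) (k : R) : Prop :=
  X != 0 /\ exists v : 'rV[R]_n,
    differential x p v = X /\ shape_operator p v = k *: X.

Definition principal_direction (p : M) (X : 'rV[R]_n.+1) : Prop :=
  exists k : R, principal p X k.

Definition position_perp (p : M) : 'rV[R]_n.+1 := dotr (x p) (N p) *: N p.

Definition position_tan (p : M) : 'rV[R]_n.+1 := x p - position_perp p.

Definition gcr : Prop :=
  forall p, position_tan p != 0 -> principal_direction p (position_tan p).

(* Meaningful only where [position_tan] does not vanish. *)
Definition e1 (p : M) : 'rV[R]_n.+1 :=
  (enorm (position_tan p))^-1 *: position_tan p.

Definition integral_curve_e1 (J : set R) (alpha : R -> M) : Prop :=
  [/\ open J, is_interval J, J !=set0, differentiable_curve J alpha &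
      forall t, J t -> position_tan (alpha t) != 0 /\
        differential x (alpha t) (velocity alpha t) = e1 (alpha t)].

Definition line_of_curvature (J : set R) (alpha : R -> M) : Prop :=
  differentiable_curve J alpha /\ forall t, J t ->
    principal_direction (alpha t) (differential x (alpha t) (velocity alpha t)).

(* The coefficients g_ij of the induced metric in the coordinates of [c]. *)
Definition metric (c : chart R n M) (a : 'rV[R]_n) : 'M[R]_n :=
  \matrix_(i, j) dotr ('d (x \o chart_inv c) a (delta_mx 0 i))
                      ('d (x \o chart_inv c) a (delta_mx 0 j)).

(* Gamma^k_ij for the Levi-Civita connection of the induced metric. *)
Definition christoffel (c : chart R n M) (k i j : 'I_n) (a : 'rV[R]_n) : R :=
  2^-1 * \sum_(l < n) invmx (metric c a) k l *
    ('D_(delta_mx 0 i) (fun b => metric c b j l) a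
     + 'D_(delta_mx 0 j) (fun b => metric c b i l) a
     - 'D_(delta_mx 0 l) (fun b => metric c b i j) a).

Definition geodesic (J : set R) (alpha : R -> M) : Prop :=
  differentiable_curve J alpha /\
  forall t c, J t -> atlas c -> chart_dom c (alpha t) ->
    let u := chart_fun c \o alpha in
    [/\ derivable u t 1, derivable (derive1 u) t 1 &
      forall k : 'I_n, derive1 (derive1 u) t 0 k
        + \sum_(i < n) \sum_(j < n)
            christoffel c k i j (u t) * derive1 u t 0 i * derive1 u t 0 j = 0].

End Hypersurface.

(** Curves in Euclidean space *)

Section EuclideanCurves.
Variables (R : realType) (m : nat).
Implicit Types (g : R -> 'rV[R]_m) (p u v w : 'rV[R]_m).

Definition unit_tangent g (t : R) : 'rV[R]_m :=
  (enorm (derive1 g t))^-1 *: derive1 g t.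

(* |dT/ds|, for a regular curve with an arbitrary parameter. *)
Definition curvature g (t : R) : R :=
  enorm (derive1 (unit_tangent g) t) / enorm (derive1 g t).

Definition orthonormal_pair u v : Prop :=
  [/\ dotr u u = 1, dotr v v = 1 & dotr u v = 0].

Definition plane p u v : set 'rV[R]_m :=
  [set q | exists a b : R, q = p + a *: u + b *: v].

(* Rotation by a positive right angle in span(u, v) oriented by (u, v). *)
Definition quarter_turn u v w : 'rV[R]_m := dotr w u *: v - dotr w v *: u.

(* The signed curvature of a curve lying in a plane directed by the
   orthonormal pair (u, v) and oriented by it. *)
Definition signed_curvature u v g (t : R) : R :=
  dotr (derive1 (unit_tangent g) t) (quarter_turn u v (unit_tangent g t))
  / enorm (derive1 g t).

End EuclideanCurves.

(* Main.v *)
(* Write T = e_1 and N for the unit tangent and the normal along alpha, and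
   f = |x^T|, rho = <x, N>.  Since e_1 is principal, N' = - k_1 T.  Differentiating
   x = rho N + f T and using <T, T'> = 0 gives T' = k_1 N.  Hence T ^ N is
   constant, so the curve lies in a plane directed by T and N, with signed
   curvature k_1; and x'' = k_1 N is normal, which in the coordinates of a chart
   is the geodesic equation. *)

Require Import Defs.
From mathcomp Require Import all_boot all_order perm all_algebra.
From mathcomp Require Import all_classical all_reals all_analysis.
From mathcomp Require Import ring lra.

Set Implicit Arguments.
Unset Strict Implicit.
Unset Printing Implicit Defensive.

Import Order.TTheory GRing.Theory Num.Theory.
Import numFieldNormedType.Exports.

Local Open Scope classical_set_scope.
Local Open Scope ring_scope.

(** * Euclidean inner product and length *)

Section Dotr.
Variables (R : realType) (m : nat).
Implicit Types u v w : 'rV[R]_m.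

Lemma dotrE u v : dotr u v = (u *m v^T) 0 0.
Proof. by rewrite mxE; apply: eq_bigr => i _; rewrite mxE. Qed.

Lemma dotrC u v : dotr u v = dotr v u.
Proof. by apply: eq_bigr => i _; rewrite mulrC. Qed.

Lemma dotrDl u v w : dotr (u + v) w = dotr u w + dotr v w.
Proof. by rewrite !dotrE mulmxDl mxE. Qed.

Lemma dotrDr u v w : dotr u (v + w) = dotr u v + dotr u w.
Proof. by rewrite dotrC dotrDl !(dotrC u). Qed.

Lemma dotrZl k u v : dotr (k *: u) v = k * dotr u v.
Proof. by rewrite !dotrE -scalemxAl mxE. Qed.

Lemma dotrZr k u v : dotr u (k *: v) = k * dotr u v.
Proof. by rewrite dotrC dotrZl dotrC. Qed.

Lemma dotrNl u v : dotr (- u) v = - dotr u v.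
Proof. by rewrite -scaleN1r dotrZl mulN1r. Qed.

Lemma dotrBl u v w : dotr (u - v) w = dotr u w - dotr v w.
Proof. by rewrite dotrDl dotrNl. Qed.

Lemma dotr0l v : dotr 0 v = 0.
Proof. by rewrite -(scale0r 0) dotrZl mul0r. Qed.

Lemma dotr0r v : dotr v 0 = 0.
Proof. by rewrite dotrC dotr0l. Qed.

Lemma dotr_suml (I : Type) (r : seq I) (P : pred I) (F : I -> 'rV[R]_m) v :
  dotr (\sum_(i <- r | P i) F i) v = \sum_(i <- r | P i) dotr (F i) v.
Proof.
by apply: (big_morph (fun u => dotr u v)) => [u w|]; rewrite ?dotrDl ?dotr0l.
Qed.

Lemma dotr_sumr (I : Type) (r : seq I) (P : pred I) (F : I -> 'rV[R]_m) v :
  dotr v (\sum_(i <- r | P i) F i) = \sum_(i <- r | P i) dotr v (F i).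
Proof. by rewrite dotrC dotr_suml; apply: eq_bigr => i _; rewrite dotrC. Qed.

Lemma dotr_ge0 u : 0 <= dotr u u.
Proof. by apply: sumr_ge0 => i _; rewrite -expr2 sqr_ge0. Qed.

Lemma dotr_eq0 u : (dotr u u == 0) = (u == 0).
Proof.
apply/idP/eqP => [/eqP u0|->]; last by rewrite dotr0l.
apply/rowP => i; rewrite mxE; apply/eqP; rewrite -sqrf_eq0 expr2.
by rewrite (psumr_eq0P _ u0)// => j _; rewrite -expr2 sqr_ge0.
Qed.

Lemma dotr_gt0 u : u != 0 -> 0 < dotr u u.
Proof. by rewrite -dotr_eq0 lt0r dotr_ge0 andbT. Qed.

Lemma sqr_enorm u : enorm u ^+ 2 = dotr u u.
Proof. by rewrite sqr_sqrtr// dotr_ge0. Qed.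

Lemma enorm_eq0 u : (enorm u == 0) = (u == 0).
Proof. by rewrite -sqrf_eq0 sqr_enorm dotr_eq0. Qed.

Lemma enormZ k u : enorm (k *: u) = `|k| * enorm u.
Proof.
by rewrite /enorm dotrZl dotrZr mulrA -expr2 sqrtrM ?sqr_ge0// sqrtr_sqr.
Qed.

End Dotr.

(** * Directional derivatives of vectors, products and inverse matrices *)

Section Derivatives.
Variable R : realType.

Lemma is_derive_mxP (V : normedModType R) (m n : nat) (M : V -> 'M[R]_(m, n))
    (t v : V) (dM : 'M[R]_(m, n)) :
  is_derive t v M dM <->
  forall i j, is_derive t v (fun x => M x i j) (dM i j).
Proof.
split=> [[dMt <-] i j|dMt].
  split; first by move/derivable_mxP : dMt.
  by rewrite (derive_mx dMt) mxE.
have dM' : derivable M t v by apply/derivable_mxP => i j; have [] := dMt i j.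
split=> //; rewrite (derive_mx dM'); apply/matrixP => i j.
by rewrite mxE; have [] := dMt i j.
Qed.

Lemma is_derive_diff_comp (V W : normedModType R) (f : R -> V) (g : V -> W)
    (t : R) (df : V) :
  is_derive t 1 f df -> differentiable g (f t) ->
  is_derive t 1 (g \o f) ('d g (f t) df).
Proof.
move=> [/derivable1_diffP ft <-] gft.
have gf : differentiable (g \o f) t by exact: differentiable_comp.
split; first exact/derivable1_diffP.
by rewrite (deriveE _ gf) diff_comp//= deriveE.
Qed.

Lemma is_derive_scale (V : normedModType R) (m : nat) (k : V -> R)
    (u : V -> 'rV[R]_m) (t v : V) (dk : R) (du : 'rV[R]_m) :
  is_derive t v k dk -> is_derive t v u du ->
  is_derive t v (fun s => k s *: u s) (k t *: du + dk *: u t).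
Proof.
move=> kt /is_derive_mxP ut; apply/is_derive_mxP => i j.
rewrite (_ : (fun x => _) = k * (fun s => u s i j)); last first.
  by apply/funext => s; rewrite mxE.
apply: (is_derive_eq (is_deriveM kt (ut i j))).
by rewrite !mxE /GRing.scale/= (mulrC (u t i j)).
Qed.

Lemma is_derive_dotr (V : normedModType R) (m : nat) (u w : V -> 'rV[R]_m)
    (t v : V) (du dw : 'rV[R]_m) :
  is_derive t v u du -> is_derive t v w dw ->
  is_derive t v (fun s => dotr (u s) (w s)) (dotr du (w t) + dotr (u t) dw).
Proof.
move=> /is_derive_mxP ut /is_derive_mxP wt.
rewrite (_ : (fun s => _) =
    \sum_(i < m) ((fun s => u s 0 i) * (fun s => w s 0 i))); last first.
  by apply/funext => s; rewrite fct_sumE.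
apply: (is_derive_eq (is_derive_sum (fun i => is_deriveM (ut 0 i) (wt 0 i)))).
 rewrite -big_split/=; apply: eq_bigr => i _.
by rewrite /GRing.scale/= addrC (mulrC (w t 0 i)).
Qed.

Lemma is_derive_sumf (V W : normedModType R) (I : Type) (r : seq I)
    (F : I -> V -> W) (dF : I -> W) (t v : V) :
  (forall i, is_derive t v (F i) (dF i)) ->
  is_derive t v (fun s => \sum_(i <- r) F i s) (\sum_(i <- r) dF i).
Proof.
move=> Ft; elim: r => [|i r IHr].
  rewrite big_nil (_ : (fun s => _) = cst 0); first exact: is_derive_cst.
  by apply/funext => s; rewrite big_nil.
rewrite big_cons (_ : (fun s => _) = F i + (fun s => \sum_(j <- r) F j s)).
  exact: is_deriveD.
by apply/funext => s; rewrite big_cons.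
Qed.

Lemma derivable_prodf (V : normedModType R) (I : Type) (r : seq I)
    (F : I -> V -> R) (t v : V) :
  (forall i, derivable (F i) t v) ->
  derivable (fun s => \prod_(i <- r) F i s) t v.
Proof.
move=> Ft; elim: r => [|i r IHr].
  rewrite (_ : (fun s => _) = cst 1); first exact: derivable_cst.
  by apply/funext => s; rewrite big_nil.
rewrite (_ : (fun s => _) = F i * (fun s => \prod_(j <- r) F j s)).
  exact: derivableM.
by apply/funext => s; rewrite big_cons.
Qed.

(** By the Leibniz formula the determinant is a sum of signed products of entries. *)
Lemma derivable_det (V : normedModType R) (n : nat) (A : V -> 'M[R]_n)
    (t v : V) :
  (forall i j, derivable (fun s => A s i j) t v) ->
  derivable (fun s => \det (A s)) t v.
Proof.
move=> At.
have dF (s : 'S_n) : derivable (fun x => (-1) ^+ s *: \prod_i A x i (s i)) t v.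
  by apply: derivableZ; apply: derivable_prodf => i.
by have [] := is_derive_sumf (index_enum _) (fun s => derivableP (dF s)).
Qed.

(** Cramer's rule reduces the inverse to determinants. This serves below to invert the metric along
    a curve. *)
Lemma derivable_invmx (V : normedModType R) (n : nat) (A : V -> 'M[R]_n)
    (t v : V) (i j : 'I_n) :
  (forall i j, derivable (fun s => A s i j) t v) ->
  (\forall s \near t, A s \in unitmx) ->
  derivable (fun s => invmx (A s) i j) t v.
Proof.
move=> At Au.
(* [invmx] returns its argument on singular matrices, so the cofactor formula is available only
   where [A s] is invertible, that is near [t]. *)
apply: (@near_eq_derivable _ _ _
  ((fun s => (\det (A s))^-1) * (fun s => cofactor (A s) j i))).
  near=> s; rewrite /invmx ifT; last by near: s.
  by rewrite !mxE.
apply: derivableM; last first.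
  apply: derivableM; first exact: derivable_cst.
  apply: derivable_det => k l.
  by rewrite (_ : (fun s => _) = (fun s => A s (lift j k) (lift i l)))//;
    apply/funext => s; rewrite !mxE.
apply: derivableV; last exact: derivable_det.
by have := nbhs_singleton Au; rewrite unitmxE unitfE.
Unshelve. all: by end_near. Qed.

(** Mean value theorem, the intermediate point staying in [J] because [J] is an interval. *)
Lemma is_derive0_cst_on (J : set R) (f : R -> R) :
  is_interval J -> (forall t, J t -> is_derive t 1 f 0) ->
  forall s t, J s -> J t -> f s = f t.
Proof.
move=> Ji df; suff H s t : J s -> J t -> s < t -> f s = f t.
  by move=> s t Js Jt; case: (ltgtP s t) => [/H->|/H->|->].
move=> Js Jt st.
have stJ x : s <= x <= t -> J x by apply: Ji.
have [||c _] := @MVT _ f (cst 0) s t st.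
- by move=> x /itvP xst; apply: df; apply: stJ; rewrite !xst.
- apply: derivable_within_continuous => x /itvP xst.
  by have [] := df x (stJ x _); rewrite ?xst.
- by rewrite mul0r => /eqP; rewrite subr_eq0 => /eqP.
Qed.

(* The second difference of [f] over the parallelogram spanned by [h *: v] and
   [h *: w] is symmetric in [v] and [w]. *)
Lemma second_difference_cvg (V : normedModType R) (f g : V -> R) (a v w : V) :
  (\forall x \near a, is_derive x v f (g x)) ->
  (\forall x \near a, differentiable f x) -> differentiable g a ->
  (h ^- 2 * (f (h *: v + h *: w + a) - f (h *: v + a) - f (h *: w + a) + f a))
    @[h --> 0^'+] --> 'D_w g a.
Proof.
move=> fg0 fd ga.
have fa : \forall x \near a, differentiable f x /\ 'D_v f x = g x.
  by near=> x; split; [near: x|apply: derive_val; near: x].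
apply/cvgrPdist_le => e e0.
(* The summand 1 keeps [k] positive even if [v] and [w] vanish. Two remainders of size
   [e' * (h * k)] will add up to [h * e], whence the factor 2 in [e']. *)
pose k := `|v| + `|w| + 1.
have k0 : 0 < k by rewrite ltr_wpDl// addr_ge0.
pose e' := e / (2 * k).
have e'0 : 0 < e' by rewrite divr_gt0// mulr_gt0.
have := diff_locally ga => /eqaddoP /(_ e' e'0).
rewrite near_simpl => -/nbhs_ballP [d1 /= d10 H1].
move/nbhs_ballP : fa => [d2 /= d20 H2].
near=> h.
have h0 : 0 < h by near: h; exact: nbhs_right_gt.
have hk s s' : 0 <= s <= h -> 0 <= s' <= h ->
    `|s *: v + s' *: w| <= h * (`|v| + `|w|).
  move=> /andP[s0 sh] /andP[s'0 s'h].
  rewrite (le_trans (ler_normD _ _))// !normrZ !ger0_norm// mulrDr.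
  by rewrite lerD// ler_wpM2r.
have hd1 : h * (`|v| + `|w|) < d1.
  apply: (@le_lt_trans _ _ (h * k)); first by rewrite ler_pM2l// lerDl.
  by rewrite -ltr_pdivlMr//; near: h; apply: nbhs_right_lt; rewrite divr_gt0.
have hd2 : h * (`|v| + `|w|) < d2.
  apply: (@le_lt_trans _ _ (h * k)); first by rewrite ler_pM2l// lerDl.
  by rewrite -ltr_pdivlMr//; near: h; apply: nbhs_right_lt; rewrite divr_gt0.
have dl s s' : 0 <= s <= h -> 0 <= s' <= h ->
    is_derive s 1 (fun x => f (x *: v + s' *: w + a))
      (g (s *: v + s' *: w + a)).
  move=> sh s'h.
  have [dfs <-] : differentiable f (s *: v + s' *: w + a) /\
      'D_v f (s *: v + s' *: w + a) = g (s *: v + s' *: w + a).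
    apply: H2; rewrite -ball_normE /ball_/= opprD addrCA subrr addr0 normrN.
    exact: le_lt_trans (hk _ _ sh s'h) hd2.
  rewrite (deriveE _ dfs).
  apply: (@is_derive_diff_comp _ _ (fun x => x *: v + s' *: w + a)) => //.
  rewrite (_ : (fun x => _) = ( *:%R^~ v) + cst (s' *: w + a)); last first.
    by apply/funext => x; rewrite -addrA.
  rewrite -[X in is_derive _ _ _ X]addr0.
  apply: is_deriveD; last exact: is_derive_cst.
  split; first by apply/derivable1_diffP.
  by rewrite deriveE// diff_val scale1r.
have h00 : 0 <= (0 : R) <= h by rewrite lexx ltW.
have hh : 0 <= h <= h by rewrite lexx ltW.
(* The second difference is [phi h - phi 0]; the mean value theorem turns it into [h] times an
   increment of [g] in the direction [w], based at [c *: v + a]. *)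
pose phi (s : R) := f (s *: v + h *: w + a) - f (s *: v + 0 *: w + a).
have dphi : forall s, 0 <= s <= h ->
    is_derive s 1 phi (g (s *: v + h *: w + a) - g (s *: v + 0 *: w + a)).
  by move=> s sh; apply: is_deriveB; exact: dl.
have [||c /itvP ch] := @MVT _ phi
   (fun s => g (s *: v + h *: w + a) - g (s *: v + 0 *: w + a)) 0 h h0.
- by move=> x /itvP xh; apply: dphi; rewrite !xh.
- apply: derivable_within_continuous => x /itvP xh.
  by have [] := dphi x _; rewrite ?xh.
have ch0 : 0 <= c <= h by rewrite !ch.
rewrite /phi !scale0r !addr0 !add0r subr0 opprB => Dh.
(* First-order expansion of [g] at [a], with one error bound for the whole parallelogram. *)
have Hr s s' : 0 <= s <= h -> 0 <= s' <= h ->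
    `|g (s *: v + s' *: w + a) - (g a + 'd g a (s *: v + s' *: w))|
      <= e' * (h * k).
  move=> sh s'h.
  have ls := hk _ _ sh s'h.
  have := H1 (s *: v + s' *: w).
  rewrite -ball_normE /ball_/= sub0r normrN => /(_ (le_lt_trans ls hd1)).
  move=> /le_trans; apply; rewrite ler_pM2l// (le_trans ls)// ler_pM2l//.
  by rewrite lerDl.
rewrite -[X in _ * X](_ : h * (g (c *: v + h *: w + a) - g (c *: v + a)) = _);
  last first.
  by rewrite mulrC -Dh; lra.
rewrite (deriveE _ ga).
have := Hr c h ch0 hh; have := Hr c 0 ch0 h00.
have -> : 'd g a (c *: v + h *: w) = 'd g a (c *: v) + h * 'd g a w.
  by rewrite linearD [X in _ + X]linearZ.
rewrite scale0r addr0.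
set A := g (_ + a); set B := g (_ + a); set C := 'd g a _.
set E := 'd g a w => HA HB.
(* The unknown point [c] contributes the same linear term [C] to both expansions; it cancels,
   leaving only the two remainders. *)
rewrite (_ : E - _ =
    h^-1 * ((A - (g a + C)) - (B - (g a + (C + h * E))))); last first.
  by field; rewrite gt_eqF.
rewrite normrM gtr0_norm ?invr_gt0// ler_pdivrMl//.
rewrite (le_trans (ler_normB _ _))// (le_trans (lerD HA HB))//.
rewrite /e' le_eqVlt; apply/orP; left; apply/eqP; field.
by rewrite gt_eqF.
Unshelve. all: by end_near. Qed.

End Derivatives.

(** * Symmetry of second derivatives *)

Section SymmetricDerivatives.
Variable R : realType.

(** Both mixed derivatives are limits of the same second difference quotient, so they agree by
    uniqueness of limits. *)
Lemma derive_sym (V : normedModType R) (f g1 g2 : V -> R) (a v w : V) :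
  (\forall x \near a, differentiable f x) ->
  (\forall x \near a, is_derive x v f (g1 x)) ->
  (\forall x \near a, is_derive x w f (g2 x)) ->
  differentiable g1 a -> differentiable g2 a ->
  'D_w g1 a = 'D_v g2 a.
Proof.
move=> fa fv fw g1a g2a.
have := @second_difference_cvg _ _ _ _ _ _ w fv fa g1a.
have := @second_difference_cvg _ _ _ _ _ _ v fw fa g2a.
rewrite [X in X @ _ --> _](_ : _ =
    (fun h => h ^- 2 * (f (h *: v + h *: w + a) -
       f (h *: v + a) - f (h *: w + a) + f a))); last first.
  apply/funext => h; rewrite [h *: w + h *: v]addrC; congr (_ * _).
  by rewrite -!addrA; congr (_ + _); rewrite addrCA.
move=> A B; apply: (@cvg_unique _ (@Rhausdorff R) _ _ _ _ B A).
Qed.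

Lemma derive_mx_sym (V : normedModType R) (m n : nat) (f : V -> 'M[R]_(m, n))
    (a v w : V) :
  (\forall x \near a, differentiable f x) ->
  differentiable ('D_v f) a -> differentiable ('D_w f) a ->
  'D_w ('D_v f) a = 'D_v ('D_w f) a.
Proof.
have dcoord (g : V -> 'M[R]_(m, n)) (x : V) i j :
    differentiable g x -> differentiable (fun y => g y i j) x.
  move=> gx; apply: (@differentiable_comp _ _ _ _ g (fun N => N i j)) => //.
  exact: differentiable_coord.
have near_coord (u : V) i j : (\forall x \near a, differentiable f x) ->
    \forall x \near a, is_derive x u (fun y => f y i j) ('D_u f x i j).
  apply: filterS => x fx; have /derivableP/is_derive_mxP : derivable f x u.
    exact: diff_derivable.
  exact.
move=> fa fv fw.
rewrite (derive_mx (diff_derivable fv)) (derive_mx (diff_derivable fw)).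
apply/matrixP => i j; rewrite [LHS]mxE [RHS]mxE.
apply: (@derive_sym _ (fun y => f y i j) (fun y => 'D_v f y i j)
  (fun y => 'D_w f y i j)).
- by apply: filterS fa => x; exact: dcoord.
- exact: near_coord.
- exact: near_coord.
- exact: dcoord.
- exact: dcoord.
Qed.

End SymmetricDerivatives.

(** * Curves and differentials in arbitrary charts *)

Section Charts.
Variables (R : realType) (n : nat) (M : manifold R n).
Implicit Types (c : chart R n M) (p : M) (alpha : R -> M).

Lemma chart_imageP c p : chart_dom c p -> (c @` chart_dom c) (c p).
Proof. by exists p. Qed.

Lemma near_chart_image c p :
  chart_dom c p -> \forall a \near c p, (c @` chart_dom c) a.
Proof.
move=> cp; apply: open_nbhs_nbhs; split; first exact: open_chart_image.
exact: chart_imageP.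
Qed.

Lemma chart_dom_funK c p : chart_dom c p -> chart_inv c (c p) = p.
Proof. by move=> cp; apply: chart_funK; rewrite inE. Qed.

Lemma near_curve_chart_dom c alpha t :
  {for t, continuous alpha} -> chart_dom c (alpha t) ->
  \forall s \near t, chart_dom c (alpha s).
Proof.
move=> at_cont ct; apply: at_cont; apply: open_nbhs_nbhs; split=> //.
exact: open_chart_dom.
Qed.

Lemma near_chart_inv_dom c c' p : chart_dom c p -> chart_dom c' p ->
  \forall a \near c p, chart_dom c' (chart_inv c a).
Proof.
move=> cp c'p; apply: (chart_inv_continuous (chart_imageP cp)).
rewrite chart_dom_funK//; apply: open_nbhs_nbhs; split=> //.
exact: open_chart_dom.
Qed.

Lemma differentiable_transition c c' p :
  atlas c -> atlas c' -> chart_dom c p -> chart_dom c' p ->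
  differentiable (c' \o chart_inv c) (c p).
Proof.
by move=> ac ac' cp c'p; apply: (atlas_compatible ac ac' [::]); exists p.
Qed.

Lemma smooth_map_differentiable m (f : M -> 'rV[R]_m) c p :
  smooth_map f -> atlas c -> chart_dom c p ->
  differentiable (f \o chart_inv c) (c p).
Proof. by move=> sf ac cp; apply: (sf c ac [::]); exists p. Qed.

Lemma derivable_chart_curve c alpha t :
  atlas c -> chart_dom c (alpha t) -> {for t, continuous alpha} ->
  derivable (chart_at (alpha t) \o alpha) t 1 -> derivable (c \o alpha) t 1.
Proof.
move=> ac ct at_cont; set c' := chart_at (alpha t) => c'at.
have c't : chart_dom c' (alpha t) by exact: chart_at_dom.
have dtr : differentiable (c \o chart_inv c') (c' (alpha t)).
  by apply: differentiable_transition => //; exact: chart_at_atlas.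
apply: (near_eq_derivable (f := (c \o chart_inv c') \o (c' \o alpha))).
  near=> s; rewrite /= chart_dom_funK//.
  by near: s; exact: near_curve_chart_dom.
by have [] := is_derive_diff_comp (derivableP c'at) dtr.
Unshelve. all: by end_near. Qed.

Lemma is_derive_along_curve m (f : M -> 'rV[R]_m) c alpha t :
  smooth_map f -> atlas c -> chart_dom c (alpha t) ->
  {for t, continuous alpha} -> derivable (c \o alpha) t 1 ->
  is_derive t 1 (f \o alpha)
    ('d (f \o chart_inv c) (c (alpha t)) (derive1 (c \o alpha) t)).
Proof.
move=> sf ac ct at_cont cat.
apply: (@near_eq_is_derive _ _ _ ((f \o chart_inv c) \o (c \o alpha))).
  near=> s; rewrite /= chart_dom_funK//.
  by near: s; exact: near_curve_chart_dom.
rewrite derive1E; apply: is_derive_diff_comp; first exact: derivableP.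
exact: smooth_map_differentiable.
Unshelve. all: by end_near. Qed.

(** Chain rule through the transition map. It makes facts about [differential], such as the
    orthogonality of the normal, usable in every chart. *)
Lemma diff_chartE m (f : M -> 'rV[R]_m) c p w :
  smooth_map f -> atlas c -> chart_dom c p ->
  'd (f \o chart_inv c) (c p) w =
    differential f p ('d (chart_at p \o chart_inv c) (c p) w).
Proof.
move=> sf ac cp; set c' := chart_at p.
have ac' : atlas c' by exact: chart_at_atlas.
have c'p : chart_dom c' p by exact: chart_at_dom.
have tr := differentiable_transition ac ac' cp c'p.
have pE : (c' \o chart_inv c) (c p) = c' p by rewrite /= chart_dom_funK.
have dfc' : differentiable (f \o chart_inv c') ((c' \o chart_inv c) (c p)).
  by rewrite pE; exact: smooth_map_differentiable.
rewrite -deriveE; last exact: smooth_map_differentiable.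
rewrite (@near_eq_derive _ _ _ _
  ((f \o chart_inv c') \o (c' \o chart_inv c))); last first.
  near=> a; rewrite /= chart_dom_funK//.
  by near: a; exact: near_chart_inv_dom.
rewrite (deriveE _ (differentiable_comp tr dfc')).
by rewrite (diff_comp tr dfc') /differential -/c' -pE.
Unshelve. all: by end_near. Qed.

(* Injectivity of the differential passes from the preferred chart at [p] to
   any other chart [c] because the differential of the transition map is
   injective, the transition map being locally invertible. *)
Lemma diff_chart_eq0 m (f : M -> 'rV[R]_m) c p w :
  smooth_map f -> injective (differential f p) ->
  atlas c -> chart_dom c p -> 'd (f \o chart_inv c) (c p) w = 0 -> w = 0.
Proof.
move=> sf inj ac cp; set c' := chart_at p.
have ac' : atlas c' by exact: chart_at_atlas.
have c'p : chart_dom c' p by exact: chart_at_dom.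
have tr := differentiable_transition ac ac' cp c'p.
have tr' := differentiable_transition ac' ac c'p cp.
have pE : (c' \o chart_inv c) (c p) = c' p by rewrite /= chart_dom_funK.
rewrite diff_chartE// => fw0; have {fw0}w0 : 'd (c' \o chart_inv c) (c p) w = 0.
  by apply: inj; rewrite fw0 /differential linear0.
(* [w] is the derivative of the identity along [w], and near [c p] the identity is the transition to
   [c'] followed by the one back; the chain rule then factors through the vanishing vector [w0]. *)
rewrite -(derive_id (c p) w).
rewrite (@near_eq_derive _ _ _ _
    ((c \o chart_inv c') \o (c' \o chart_inv c))); last first.
  near=> a.
  have c'a : chart_dom c' (chart_inv c a) by near: a; exact: near_chart_inv_dom.
  have [q cq qa] : (c @` chart_dom c) a by near: a; exact: near_chart_image.
  by rewrite /= chart_dom_funK// -qa chart_dom_funK.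
have dtr' : differentiable (c \o chart_inv c') ((c' \o chart_inv c) (c p)).
  by rewrite pE.
rewrite (deriveE _ (differentiable_comp tr dtr')).
rewrite (diff_comp tr dtr').
by apply: etrans (congr1 _ w0) _; rewrite linear0.
Unshelve. all: by end_near. Qed.

End Charts.

(** * Rotations in a plane and moving frames *)

Section QuarterTurn.
Variables (R : realType) (m : nat).
Implicit Types u v w : 'rV[R]_m.

Lemma quarter_turn_l u v : orthonormal_pair u v -> quarter_turn u v u = v.
Proof.
by case=> uu _ uv; rewrite /quarter_turn uu uv scale1r scale0r subr0.
Qed.

Lemma quarter_turn_r u v : orthonormal_pair u v -> quarter_turn u v v = - u.
Proof.
case=> _ vv uv.
by rewrite /quarter_turn vv dotrC uv scale1r scale0r add0r.
Qed.

(** A quarter turn takes values in span(u, v), where the projection acts as the identity. *)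
Lemma orthogonal_projection_quarter_turn u v w : orthonormal_pair u v ->
  let q := quarter_turn u v w in dotr q u *: u + dotr q v *: v = q.
Proof.
case=> uu vv uv; rewrite /quarter_turn !dotrBl !dotrZl uu vv uv (dotrC v) uv.
by rewrite !mulr0 !mulr1 sub0r subr0 scaleNr addrC.
Qed.

End QuarterTurn.

(* The two-dimensional Frenet equations, except that [k] is not required to be
   continuous: [T ^ N] is constant along the curve. *)
Section PlaneFrame.
Variables (R : realType) (m : nat) (J : set R).
Variables (gamma T N : R -> 'rV[R]_m) (k : R -> R).
Hypothesis J_itv : is_interval J.
Hypothesis TN_orthonormal : forall t, J t -> orthonormal_pair (T t) (N t).
Hypothesis derive_gamma : forall t, J t -> is_derive t 1 gamma (T t).
Hypothesis derive_T : forall t, J t -> is_derive t 1 T (k t *: N t).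
Hypothesis derive_N : forall t, J t -> is_derive t 1 N (- k t *: T t).

Lemma row_derive0_cst (f : R -> 'rV[R]_m) :
  (forall t, J t -> is_derive t 1 f 0) -> forall s t, J s -> J t -> f s = f t.
Proof.
move=> f0 s t Js Jt; apply/rowP => j.
apply: (is_derive0_cst_on (f := fun x => f x 0 j) J_itv) => // x Jx.
by have /is_derive_mxP/(_ 0 j) := f0 _ Jx; rewrite mxE.
Qed.

(** The quarter turn is the bivector T ^ N contracted with [w]. Differentiating it produces only k N
    ^ N and k T ^ T, which vanish. *)
Lemma quarter_turn_cst w s t : J s -> J t ->
  quarter_turn (T s) (N s) w = quarter_turn (T t) (N t) w.
Proof.
apply: (row_derive0_cst (f := fun x => quarter_turn (T x) (N x) w)) => x Jx.
have dT := derive_T Jx; have dN := derive_N Jx.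
have dw : is_derive x 1 (fun=> w) (0 : 'rV[R]_m) by exact: is_derive_cst.
apply: (is_derive_eq (is_deriveB
  (is_derive_scale (is_derive_dotr dw dT) dN)
  (is_derive_scale (is_derive_dotr dw dN) dT))).
rewrite !dotr0l !add0r !dotrZr !scalerA.
apply/rowP => j; rewrite !mxE; ring.
Qed.

Lemma quarter_turn_frame s t : J s -> J t ->
  quarter_turn (T s) (N s) (T t) = N t.
Proof.
move=> Js Jt; rewrite (quarter_turn_cst _ Js Jt).
by apply: quarter_turn_l; exact: TN_orthonormal.
Qed.

Lemma frame_curve_in_plane t0 : J t0 ->
  exists p, forall t, J t -> plane p (T t0) (N t0) (gamma t).
Proof.
move=> J0; set u := T t0; set v := N t0.
have uv : orthonormal_pair u v by exact: TN_orthonormal.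
(* The component of [gamma t] orthogonal to span(u, v). Once shown constant, it is the base point of
   the plane. *)
pose f t := gamma t - (dotr (gamma t) u *: u + dotr (gamma t) v *: v).
exists (f t0) => t Jt; exists (dotr (gamma t) u), (dotr (gamma t) v).
suff -> : f t0 = f t by rewrite -addrA subrK.
apply: row_derive0_cst => // {Jt}t Jt.
have dg := derive_gamma Jt.
have dc (w : 'rV[R]_m) : is_derive t 1 (fun=> w) (0 : 'rV[R]_m).
  exact: is_derive_cst.
apply: (is_derive_eq (is_deriveB dg (is_deriveD
  (is_derive_scale (is_derive_dotr dg (dc u)) (dc u))
  (is_derive_scale (is_derive_dotr dg (dc v)) (dc v))))).
rewrite !dotr0r !addr0 !scaler0 !add0r.
(* In its own frame [T t] is the quarter turn of [- N t]; by constancy the frame at [t0] gives the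
   same vector, so [T t] lies in span(u, v). *)
have -> : T t = quarter_turn u v (- N t).
  rewrite (quarter_turn_cst _ J0 Jt) -scaleN1r -[LHS]opprK.
  rewrite -(quarter_turn_r (TN_orthonormal Jt)) /quarter_turn !dotrZl.
  by rewrite !mulN1r !scaleNr opprB opprK addrC.
by rewrite orthogonal_projection_quarter_turn// subrr.
Qed.

End PlaneFrame.

(** The linear algebra behind T' = k N. Pairing the equation with [e] gives [df = 1 + rho * k]; then
    all multiples of [e] cancel, and dividing by [f] leaves the claim. *)
Lemma decomposition_derivative (R : realType) (m : nat) (e v de : 'rV[R]_m)
    (rho k f df : R) :
  f != 0 -> dotr e e = 1 -> dotr e v = 0 -> dotr de e = 0 ->
  e = rho *: (- k *: e) + (- k * f) *: v + (f *: de + df *: e) -> k *: v = de.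
Proof.
move=> f0 ee ev dee eE; apply: (scalerI f0).
have : dotr e e = - (rho * k) + df.
  by rewrite {1}eE !dotrDl !dotrZl ee (dotrC v) ev dee; ring.
rewrite ee => dfE.
have -> : f *: de = e - rho *: (- k *: e) - (- k * f) *: v - df *: e.
  by rewrite {1}eE; apply/rowP => j; rewrite !mxE; ring.
have -> : df = 1 + rho * k by rewrite dfE; ring.
by apply/rowP => j; rewrite !mxE; ring.
Qed.

(** * The frame [e1], [N] along an integral curve *)

Section IntegralCurve.
Variables (R : realType) (n : nat) (M : hypersurface R n) (k1 : M -> R).
Hypothesis k1_principal :
  forall p : M, position_tan p != 0 -> principal p (e1 p) (k1 p).
Variables (J : set R) (alpha : R -> M).
Hypothesis alpha_e1 : integral_curve_e1 J alpha.

Local Notation x := (@position R n M).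
Local Notation N := (@normal R n M).
Local Notation E1 := (@e1 R n M).

Let near_J t : J t -> \forall s \near t, J s.
Proof. by case: alpha_e1 => oJ _ _ _ _ Jt; apply: open_nbhs_nbhs. Qed.

Lemma is_derive_position_curve t : J t ->
  is_derive t 1 (x \o alpha) (e1 (alpha t)).
Proof.
case: alpha_e1 => _ _ _ dalpha He1 Jt.
have [_ <-] := He1 t Jt; have [at_cont at_der] := dalpha t Jt.
apply: is_derive_along_curve => //.
- exact: position_smooth.
- exact: chart_at_atlas.
- exact: chart_at_dom.
Qed.

Lemma is_derive_normal_curve t : J t ->
  is_derive t 1 (N \o alpha) (- k1 (alpha t) *: e1 (alpha t)).
Proof.
case: alpha_e1 => _ _ _ dalpha He1 Jt.
have [tan0 dx] := He1 t Jt; have [at_cont at_der] := dalpha t Jt.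
have [_ [v [dxv Sv]]] := k1_principal tan0.
(* The eigenvector hidden in [principal] and the velocity have the same image [e1], and the
   immersion is injective on tangent vectors. *)
have vE : v = velocity alpha t.
  by apply: (@position_immersion R n M (alpha t)); rewrite dxv dx.
have -> : - k1 (alpha t) *: e1 (alpha t) =
    differential N (alpha t) (velocity alpha t).
  by rewrite scaleNr -Sv vE opprK.
apply: is_derive_along_curve => //.
- exact: normal_smooth.
- exact: chart_at_atlas.
- exact: chart_at_dom.
Qed.

Lemma dotr_tan_normal (p : M) : dotr (position_tan p) (N p) = 0.
Proof. by rewrite dotrBl dotrZl normal_unit mulr1 subrr. Qed.

Lemma dotr_e1_normal (p : M) : dotr (e1 p) (N p) = 0.
Proof. by rewrite dotrZl dotr_tan_normal mulr0. Qed.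

Lemma dotr_e1 (p : M) : position_tan p != 0 -> dotr (e1 p) (e1 p) = 1.
Proof.
move=> p0; rewrite dotrZl dotrZr mulrA -expr2 exprVn sqr_enorm mulVf//.
by rewrite dotr_eq0.
Qed.

Lemma e1_frame t : J t -> orthonormal_pair (e1 (alpha t)) (N (alpha t)).
Proof.
move=> Jt; have [_ _ _ _ /(_ t Jt)[p0 _]] := alpha_e1.
by split; [exact: dotr_e1|exact: normal_unit|exact: dotr_e1_normal].
Qed.

(* Differentiate [x = rho N + f e1], where [rho = <x, N>] and [f = |x^T|]. *)
Lemma is_derive_e1_curve t : J t ->
  is_derive t 1 (E1 \o alpha) (k1 (alpha t) *: N (alpha t)).
Proof.
move=> Jt; have [_ _ _ _ /(_ t Jt)[tan0 _]] := alpha_e1.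
have dx := is_derive_position_curve Jt; have dN := is_derive_normal_curve Jt.
have [ee NN eN] := e1_frame Jt.
have drho := is_derive_dotr dx dN.
have dtan : derivable (fun s => position_tan (alpha s)) t 1.
  by have [] := is_deriveB dx (is_derive_scale drho dN).
have dsq := is_derive_dotr (derivableP dtan) (derivableP dtan).
have := is_derive1_comp (is_derive1_sqrt (dotr_gt0 tan0)) dsq.
set f := Num.sqrt \o _; set df := (X in is_derive t 1 f X) => ft.
have ft0 : f t != 0 by rewrite /f /= sqrtr_eq0 -ltNge dotr_gt0.
(* Regularity first: [e1] is the quotient of x^T by its length, both derivable along the curve since
   [f t] is nonzero. The value of the derivative is found afterwards. *)
have de1 : derivable (E1 \o alpha) t 1.
  by have [] := is_derive_scale (is_deriveV ft0 ft) (derivableP dtan).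
have De1 := derivableP de1; set De := 'D_1 _ t in De1.
suff -> : k1 (alpha t) *: N (alpha t) = De by [].
(* [e1] has unit length on [J], which is open, hence near [t]. *)
have eDe : dotr De (e1 (alpha t)) = 0.
  have := is_derive_dotr De1 De1.
  have c1 : is_derive t 1 (fun s => dotr ((E1 \o alpha) s) ((E1 \o alpha) s))
      (0 : R).
    apply: (near_eq_is_derive (f := (cst 1 : R -> R))).
    near=> s; have [] : orthonormal_pair (e1 (alpha s)) (N (alpha s)) => //.
    by apply: e1_frame; near: s; exact: near_J.
  case=> _; rewrite (@derive_val _ _ _ _ _ _ _ c1) /= (dotrC (e1 _)); lra.
have dx' := is_deriveD (is_derive_scale drho dN) (is_derive_scale ft De1).
(* An equality of functions on all of [R]: where x^T vanishes, the default value of [e1] still makes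
   both tangential parts zero. *)
have xE : x \o alpha = (fun s => dotr ((x \o alpha) s) ((N \o alpha) s) *:
    (N \o alpha) s) + (fun s => f s *: (E1 \o alpha) s).
  apply/funext => s; rewrite /f -[LHS](subrK (position_perp (alpha s))) addrC.
  congr (_ + _); rewrite /= /e1 -/(position_tan _).
  have [->|tan_s] := eqVneq (position_tan (alpha s)) 0.
    by rewrite scaler0 scaler0.
  by rewrite scalerA mulfV ?scale1r// enorm_eq0.
rewrite -xE in dx'; have := derive_val (is_derive := dx').
rewrite (derive_val (is_derive := dx)) /=.
(* This identifies the derivative of rho, namely <x, N'> = - k1 <x, e1>, with [- k1 * f]. *)
have xe : dotr (x (alpha t)) (e1 (alpha t)) = f t.
  rewrite -[x _](subrK (position_perp (alpha t))) -/(position_tan _) dotrDl.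
  rewrite [dotr (position_perp _) _]dotrZl (dotrC (N _)) eN mulr0 addr0.
  by rewrite dotrZr -sqr_enorm expr2 mulKf// enorm_eq0.
rewrite eN add0r dotrZr xe.
set rho := dotr (x _) (N _) => eE.
exact: (decomposition_derivative ft0 ee eN eDe eE).
Unshelve. all: by end_near. Qed.

End IntegralCurve.

(** * Metric, Christoffel symbols and geodesic equation in coordinates *)

Lemma diff_row_sum (R : realType) (n : nat) (W : normedModType R)
    (f : 'rV[R]_n -> W) (a w : 'rV[R]_n) : differentiable f a ->
  'd f a w = \sum_(j < n) w 0 j *: 'D_(delta_mx 0 j) f a.
Proof.
move=> fa; rewrite {1}[w]row_sum_delta linear_sum; apply: eq_bigr => j _.
by rewrite linearZ/= deriveE.
Qed.

Section Coordinates.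
Variables (R : realType) (n : nat) (M : hypersurface R n) (c : chart R n M).
Hypothesis c_atlas : atlas c.

Local Notation x := (@position R n M).
Local Notation X := (x \o chart_inv c).
Local Notation d_ i := (delta_mx (0 : 'I_1) i).
Local Notation U := (c @` chart_dom c).
Local Notation E i := ('D_(d_ i) X).
Local Notation g := (metric c).

Let near_U a : U a -> \forall b \near a, U b.
Proof.
by move=> Ua; apply: open_nbhs_nbhs; split=> //; exact: open_chart_image.
Qed.

Let differentiable_X a : U a -> differentiable X a.
Proof. exact: (@position_smooth R n M c c_atlas [::]). Qed.

Let differentiable_E i a : U a -> differentiable (E i) a.
Proof. exact: (@position_smooth R n M c c_atlas [:: d_ i]). Qed.

Lemma derive_coord_sym i j a : U a -> 'D_(d_ j) (E i) a = 'D_(d_ i) (E j) a.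
Proof.
move=> Ua; apply: derive_mx_sym; try exact: differentiable_E.
by apply: filterS (near_U Ua); exact: differentiable_X.
Qed.

Lemma metricE a i j : U a -> g a i j = dotr (E i a) (E j a).
Proof. by move=> Ua; rewrite mxE !deriveE//; exact: differentiable_X. Qed.

Lemma mul_row_metric a w : U a ->
  w *m g a = \row_l dotr ('d X a w) (E l a).
Proof.
move=> Ua; apply/rowP => l; rewrite !mxE diff_row_sum; last first.
  exact: differentiable_X.
by rewrite dotr_suml; apply: eq_bigr => i _; rewrite metricE// dotrZl.
Qed.

(** A row vector killed by the Gram matrix has an image orthogonal to every coordinate vector, hence
    to itself; the immersion then forces it to be zero. *)
Lemma metric_unitmx a : U a -> g a \in unitmx.
Proof.
move=> Ua; rewrite -row_free_unit; apply: inj_row_free => w.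
rewrite mul_row_metric// => /rowP w0.
have dXw : 'd X a w = 0.
  apply/eqP; rewrite -dotr_eq0 {2}diff_row_sum; last exact: differentiable_X.
  rewrite dotr_sumr big1// => i _; have := w0 i.
  by rewrite !mxE dotrZr => ->; rewrite mulr0.
case: Ua dXw => p cp <-; apply: diff_chart_eq0 => //.
  exact: position_smooth.
exact: position_immersion.
Qed.

Lemma metric_sym a : (g a)^T = g a.
Proof. by apply/matrixP => i j; rewrite !mxE dotrC. Qed.

Lemma derive_metric i j l a : U a ->
  'D_(d_ i) (fun b => g b j l) a =
    dotr ('D_(d_ i) (E j) a) (E l a) + dotr (E j a) ('D_(d_ i) (E l) a).
Proof.
move=> Ua; rewrite (@near_eq_derive _ _ _ _ (fun b => dotr (E j b) (E l b))).
  have dE k : is_derive a (d_ i) (E k) ('D_(d_ i) (E k) a).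
    by apply: derivableP; apply: diff_derivable; exact: differentiable_E.
  exact: (derive_val (is_derive := is_derive_dotr (dE j) (dE l))).
by apply: filterS (near_U Ua) => b; exact: metricE.
Qed.

(** The three metric derivatives expand into six products. By symmetry of second derivatives four of
    them cancel and the other two coincide, absorbing the factor 1/2. So the symbols are the
    coordinates of the tangential part of the second derivatives of [X]. *)
Lemma christoffelE k i j a : U a ->
  christoffel c k i j a =
    \sum_(l < n) invmx (g a) k l * dotr ('D_(d_ j) (E i) a) (E l a).
Proof.
move=> Ua; pose H p q := 'D_(d_ q) (E p) a.
have H_sym p q : H p q = H q p by exact: derive_coord_sym.
have dg p q r : 'D_(d_ p) (fun b => g b q r) a =
    dotr (H q p) (E r a) + dotr (E q a) (H r p) by exact: derive_metric.
rewrite /christoffel mulr_sumr; apply: eq_bigr => l _.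
rewrite (dg i j l) (dg j i l) (dg l i j) -/(H i j).
clearbody H; rewrite (H_sym j i) (H_sym l i) (H_sym l j).
move: (E i a) (E j a) (E l a) => ei ej el; rewrite (dotrC ej). by field.
Qed.

Section Curve.
Variables (u : R -> 'rV[R]_n) (T : R -> 'rV[R]_n.+1) (dT : 'rV[R]_n.+1) (t : R).
Hypothesis u_in_U : \forall s \near t, U (u s).
Hypothesis u_derivable : derivable u t 1.
Hypothesis u_velocity : \forall s \near t, 'd X (u s) (derive1 u s) = T s.
Hypothesis T_derive : is_derive t 1 T dT.

Let Ut : U (u t). Proof. exact: nbhs_singleton u_in_U. Qed.

Let derive_E i : is_derive t 1 (fun s => E i (u s))
  (\sum_(j < n) derive1 u t 0 j *: 'D_(d_ j) (E i) (u t)).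
Proof.
rewrite -diff_row_sum; last exact: differentiable_E.
rewrite derive1E; apply: (is_derive_diff_comp (g := E i)).
  exact: derivableP.
exact: differentiable_E.
Qed.

(* The velocity solves a linear system whose matrix is the metric, hence it is
   as regular along the curve as the Euclidean velocity. *)
Lemma derivable_velocity : derivable (derive1 u) t 1.
Proof.
pose b s : 'rV[R]_n := \row_l dotr (T s) (E l (u s)).
apply: (near_eq_derivable (f := fun s => b s *m invmx (g (u s)))).
  near=> s; have Us : U (u s) by near: s.
  have <- : derive1 u s *m g (u s) = b s.
    rewrite mul_row_metric//; apply/rowP => l; rewrite [LHS]mxE [RHS]mxE.
    by congr (dotr _ _); near: s.
  by rewrite mulmxK// metric_unitmx.
apply/derivable_mxP => i k.
have dterm l : derivable (fun s => b s i l * invmx (g (u s)) l k) t 1.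
  apply: (@derivableM _ _ (fun s => b s i l) (fun s => invmx (g (u s)) l k)).
    have [db _] := is_derive_dotr T_derive (derive_E l).
    apply: near_eq_derivable db; by near=> s; rewrite mxE.
  apply: derivable_invmx => [i' j'|].
    have [dg _] := is_derive_dotr (derive_E i') (derive_E j').
    apply: near_eq_derivable dg; by near=> s; rewrite metricE//; near: s.
  by near=> s; apply: metric_unitmx; near: s.
have [ds _] := is_derive_sumf (index_enum _) (fun l => derivableP (dterm l)).
by apply: near_eq_derivable ds; near=> s; rewrite mxE.
Unshelve. all: by end_near. Qed.

(** Differentiating T = sum u_i' E_i expresses [dT] by the second derivatives of [u] and of [X].
    Pairing with each [E l] annihilates [dT], and the inverse metric isolates u''. *)
Lemma geodesic_equation k : (forall l, dotr dT (E l (u t)) = 0) ->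
  derive1 (derive1 u) t 0 k + \sum_(i < n) \sum_(j < n)
    christoffel c k i j (u t) * derive1 u t 0 i * derive1 u t 0 j = 0.
Proof.
move=> dT0.
set v := derive1 u.
have dv := derivableP derivable_velocity; rewrite -derive1E -/v in dv.
set a := derive1 v t in dv *.
have /is_derive_mxP dvi := dv.
have dsum := is_derive_sumf (index_enum _)
  (fun i => is_derive_scale (dvi 0 i) (derive_E i)).
have : is_derive t 1 (fun s => \sum_(i < n) v s 0 i *: E i (u s)) dT.
  apply: near_eq_is_derive T_derive; near=> s.
  rewrite -diff_row_sum; last by apply: differentiable_X; near: s.
  by apply/esym; near: s.
case=> _; rewrite (derive_val (is_derive := dsum)) => dTE.
pose q l := \sum_(i < n) \sum_(j < n)
  v t 0 i * v t 0 j * dotr ('D_(d_ j) (E i) (u t)) (E l (u t)).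
have ag : a *m g (u t) = - \row_l q l.
  apply/rowP => l; rewrite mul_row_metric// !mxE; apply/eqP.
  rewrite -addr_eq0 -(dT0 l) -dTE diff_row_sum; last exact: differentiable_X.
  rewrite big_split/= dotrDl addrC !dotr_suml; apply/eqP; congr (_ + _).
  apply: eq_bigr => i _; rewrite dotrZl dotr_suml mulr_sumr.
  by apply: eq_bigr => j _; rewrite dotrZl mulrA.
have -> : a = - ((\row_l q l) *m invmx (g (u t))).
  by rewrite -mulNmx -ag mulmxK// metric_unitmx.
rewrite 2!mxE addrC; apply/eqP; rewrite subr_eq0; apply/eqP.
under eq_bigr do under eq_bigr do
  rewrite christoffelE// -mulrA mulr_suml.
under [RHS]eq_bigr do rewrite mxE mulr_suml.
rewrite [RHS]exchange_big; apply: eq_bigr => i _.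
under [RHS]eq_bigr do rewrite mulr_suml.
rewrite [RHS]exchange_big; apply: eq_bigr => j _.
apply: eq_bigr => l _.
(* Solving with row vectors puts the inverse metric on the right, which transposes its indices
   relative to [christoffel]. *)
have -> : invmx (g (u t)) l k = invmx (g (u t)) k l.
  by rewrite -[in RHS]metric_sym -trmx_inv mxE.
ring.
Unshelve. all: by end_near. Qed.

End Curve.

End Coordinates.

(** * Integral curves of [e1] are geodesics *)

Section Geodesic.
Variables (R : realType) (n : nat) (M : hypersurface R n) (k1 : M -> R).
Hypothesis k1_principal :
  forall p : M, position_tan p != 0 -> principal p (e1 p) (k1 p).
Variables (J : set R) (alpha : R -> M).
Hypothesis alpha_e1 : integral_curve_e1 J alpha.

Lemma integral_curve_geodesic : geodesic J alpha.
Proof.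
have [oJ _ _ dalpha _] := alpha_e1.
split=> // t c Jt ac ct u.
have [at_cont at_der] := dalpha t Jt.
have near_J : \forall s \near t, J s by exact: open_nbhs_nbhs.
have near_c := near_curve_chart_dom at_cont ct.
have du s : J s -> chart_dom c (alpha s) -> derivable u s 1.
  by move=> Js cs; have [? ?] := dalpha s Js; exact: derivable_chart_curve.
have u_in_U : \forall s \near t, (c @` chart_dom c) (u s).
  by apply: filterS near_c => s cs; exists (alpha s).
(* The derivative of the position along the curve is computed twice, in [c] and in the preferred
   chart. *)
have u_velocity : \forall s \near t,
    'd (@position R n M \o chart_inv c) (u s) (derive1 u s) =
      (@e1 R n M \o alpha) s.
  near=> s.
  have Js : J s by near: s.
  have cs : chart_dom c (alpha s) by near: s.
  have [s_cont _] := dalpha s Js.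
  have dx := is_derive_along_curve (@position_smooth R n M) ac cs s_cont
    (du s Js cs).
  have dx' := is_derive_position_curve alpha_e1 Js.
  by rewrite -(derive_val (is_derive := dx)) (derive_val (is_derive := dx')).
have dT := is_derive_e1_curve k1_principal alpha_e1 Jt.
have dut := du t Jt ct.
split; [exact: dut|exact: (derivable_velocity ac u_in_U dut u_velocity dT)|].
move=> k; apply: (geodesic_equation ac u_in_U dut u_velocity dT) => l.
have sx := @position_smooth R n M.
(* The acceleration is a multiple of the normal, while [E l] is the image of a tangent vector. *)
rewrite deriveE; last exact: smooth_map_differentiable.
by rewrite /u /= diff_chartE// dotrZl normal_orthogonal mulr0.
Unshelve. all: by end_near. Qed.

End Geodesic.

(** * Geodesy, line of curvature, planarity and curvature together *)

Theorem proposition3p2 (R : realType) (n : nat) (M : hypersurface R n)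
    (M_gcr : gcr M) (k1 : M -> R)
    (k1_principal : forall p : M,
       position_tan p != 0 -> principal p (e1 p) (k1 p))
    (J : set R) (alpha : R -> M) (alpha_e1 : integral_curve_e1 J alpha) :
  let gamma : R -> 'rV[R]_n.+1 := fun t => position (alpha t) in
  [/\ geodesic J alpha,
      line_of_curvature J alpha,
      (exists p u v : 'rV[R]_n.+1,
         [/\ orthonormal_pair u v,
             (forall t, J t -> plane p u v (gamma t)),
             (forall t, J t ->
                quarter_turn u v (unit_tangent gamma t) = normal (alpha t)) &
             (forall t, J t -> signed_curvature u v gamma t = k1 (alpha t))]) &
      (forall t, J t -> curvature gamma t = `|k1 (alpha t)|)].
Proof.
move=> gamma.
have [oJ Ji [t0 J0] dalpha He1] := alpha_e1.
pose T := @e1 R n M \o alpha; pose N := @normal R n M \o alpha.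
have TN t : J t -> orthonormal_pair (T t) (N t) by exact: e1_frame.
have dgamma t : J t -> is_derive t 1 gamma (T t).
  exact: is_derive_position_curve.
have dT t : J t -> is_derive t 1 T (k1 (alpha t) *: N t).
  exact: is_derive_e1_curve.
have dN t : J t -> is_derive t 1 N (- k1 (alpha t) *: T t).
  exact: is_derive_normal_curve.
have enorm1 (w : 'rV[R]_n.+1) : dotr w w = 1 -> enorm w = 1.
  by move=> w1; rewrite /enorm w1 sqrtr1.
have gamma'E t : J t -> derive1 gamma t = T t.
  by move=> Jt; rewrite derive1E (derive_val (is_derive := dgamma t Jt)).
have enorm_gamma' t : J t -> enorm (derive1 gamma t) = 1.
  by move=> Jt; have [TT _ _] := TN t Jt; rewrite gamma'E// enorm1.
have unit_tangentE t : J t -> unit_tangent gamma t = T t.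
  by move=> Jt; rewrite /unit_tangent enorm_gamma'// invr1 scale1r gamma'E.
have unit_tangent'E t : J t ->
    derive1 (unit_tangent gamma) t = k1 (alpha t) *: N t.
  move=> Jt; rewrite derive1E (near_eq_derive (g := T)).
    exact: (derive_val (is_derive := dT t Jt)).
  have : \forall s \near t, J s by exact: open_nbhs_nbhs.
  by apply: filterS => s; exact: unit_tangentE.
(* The frame at the single parameter [t0] orients the plane; this orientation gives the signed
   curvature the sign of [k1]. *)
have turnE t : J t ->
    quarter_turn (T t0) (N t0) (unit_tangent gamma t) = N t.
  move=> Jt; rewrite unit_tangentE//.
  exact: (quarter_turn_frame Ji TN dT dN).
split.
- exact: (integral_curve_geodesic k1_principal alpha_e1).
- split=> // t Jt; have [tan0 ->] := He1 t Jt.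
  by exists (k1 (alpha t)); exact: k1_principal.
- have [p planep] := frame_curve_in_plane Ji TN dgamma dT dN J0.
  exists p, (T t0), (N t0); split=> // [|t Jt]; first exact: TN.
  rewrite /signed_curvature turnE// unit_tangent'E// enorm_gamma'// divr1.
  by have [_ NN _] := TN t Jt; rewrite dotrZl NN mulr1.
- move=> t Jt; rewrite /curvature unit_tangent'E// enorm_gamma'// divr1.
  by have [_ NN _] := TN t Jt; rewrite enormZ enorm1// mulr1.
Qed.
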